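(* Let $f\in\mathcal{C}$ and let $y=y(x)$ be such that $u=\log x/\log y\asymp\log\log x$. Then $$\frac1x\,\#\left\{n\le x:\frac{f(n;y)-\mu(f;y)}{\sigma(f;y)}\ge\Delta\right\}\sim\mathbb{P}\left(\sum_{p\le y}f(p)\Big[X_p-\frac1p\Big]\ge\Delta\,\sigma(f;y)\right)\qquad(x\to\infty)$$ uniformly in $1\le\Delta\le c\,\sigma(f;y)$ for any fixed $c>0$.
   Context: $f(n;y)=\sum_{p\mid n,\ p\le y}f(p)$ is the truncated additive function. The $X_p$ ($p$ prime) are independent random variables with $\mathbb{P}(X_p=1)=1/p$ and $\mathbb{P}(X_p=0)=1-1/p$. For a strongly additive function $g$ (i.e. $g(p^k)=g(p)$ for all primes $p$ and $k\ge1$, and $g(mn)=g(m)+g(n)$ for $(m,n)=1$), let $$\mu(g;x)=\sum_{p\le x}\frac{g(p)}{p},\qquad \sigma^2(g;x)=\sum_{p\le x}\frac{g(p)^2}{p}\Big(1-\frac1p\Big),\quad \sigma(g;x)\ge0.$$ Class $\mathcal{C}$: an additive function $g$ belongs to $\mathcal{C}$ if and only if (i) $g$ is strongly additive and strictly positive ($g(p)>0$ for all primes $p$); (ii) for every $A>0$, for all $t\ge0$, $x\ge2$, $\frac{1}{\pi(x)}\#\{p\le x: g(p)\ge t\}=O_A(e^{-At})$; (iii) there is a distribution function $\Psi(g;t)$ with non-zero second moment such that for all $k>0$, $\frac{1}{\pi(x)}\#\{p\le x: g(p)\le t\}-\Psi(g;t)=O_k\big((\log x)^{-k}\big)$ uniformly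 in $t\in\mathbb{R}$. *)

(* Defs.v *)
From HB Require Import structures.
From mathcomp Require Import all_boot all_order all_algebra.
From mathcomp Require Import all_classical all_reals all_analysis.
Set Implicit Arguments.
Unset Strict Implicit.
Unset Printing Implicit Defensive.
Import Order.TTheory GRing.Theory Num.Theory.
Import numFieldNormedType.Exports.

Local Open Scope classical_set_scope.
Local Open Scope ring_scope.

(* An arithmetic function is a map nat -> R; its value at 0 is never used. *)

(* [Num.truncn x] is the integer part of [x] when [0 <= x] and 0 otherwise, so
   that this is the list of primes at most [x] for every real [x]. *)
Definition primes_upto (R : realType) (x : R) : seq nat :=
  [seq p <- iota 0 (Num.truncn x).+1 | prime p].

Definition primepi (R : realType) (x : R) : nat := size (primes_upto x).

Definition prime_count (R : realType) (a : pred nat) (x : R) : nat :=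
  count a (primes_upto x).

Definition strongly_additive (R : realType) (g : nat -> R) : Prop :=
  (forall m n, (0 < m)%N -> (0 < n)%N -> coprime m n ->
     g (m * n)%N = g m + g n) /\
  (forall p k, prime p -> (0 < k)%N -> g (p ^ k)%N = g p).

Definition meanf (R : realType) (g : nat -> R) (x : R) : R :=
  \sum_(p <- primes_upto x) g p / p%:R.

Definition sigmaf (R : realType) (g : nat -> R) (x : R) : R :=
  Num.sqrt (\sum_(p <- primes_upto x) g p ^+ 2 / p%:R * (1 - p%:R^-1)).

Definition truncated (R : realType) (f : nat -> R) (n : nat) (y : R) : R :=
  \sum_(p <- primes_upto y | (p %| n)%N) f p.

(* Second moment of the probability law with distribution function [Psi];
   [cumulativeBounded 0 1] is the type of nondecreasing right-continuous
   functions with limits 0 at -oo and 1 at +oo. *)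
Definition second_moment (R : realType) (Psi : cumulativeBounded (0 : R) (1 : R))
    : \bar R :=
  (\int[lebesgue_stieltjes_measure Psi]_t (t ^+ 2)%:E)%E.

Record classC (R : realType) (g : nat -> R) : Prop := ClassC {
  classC_additive : strongly_additive g ;
  classC_pos : forall p, prime p -> 0 < g p ;
  classC_tail : forall A : R, 0 < A ->
    exists C : R, forall t x : R, 0 <= t -> 2 <= x ->
      (prime_count (fun p => t <= g p) x)%:R / (primepi x)%:R
        <= C * expR (- A * t) ;
  classC_distr : exists Psi : cumulativeBounded (0 : R) (1 : R),
    second_moment Psi != 0%E /\
    forall k : R, 0 < k ->
      exists C : R, forall x t : R, 2 <= x ->
        `| (prime_count (fun p => g p <= t) x)%:R / (primepi x)%:R - Psi t |
          <= C * ln x `^ (- k) }.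

(* [X i], for [i] satisfying [D], are mutually independent: the product rule
   for all finite subfamilies and all Borel sets. *)
Definition mutually_independent (d : measure_display) (T : measurableType d)
    (R : realType) (P : probability T R) (I : eqType) (D : pred I)
    (X : I -> {RV P >-> R}) : Prop :=
  forall (s : seq I) (B : I -> set R), uniq s -> all D s ->
    (forall i, measurable (B i)) ->
    P (\bigcap_(i in [set` s]) (X i @^-1` B i)) =
      (\prod_(i <- s) P (X i @^-1` B i))%E.

Definition bernoulli_primes (d : measure_display) (T : measurableType d)
    (R : realType) (P : probability T R) (X : nat -> {RV P >-> R}) : Prop :=
  mutually_independent prime X /\
  (forall p, prime p ->
     P (X p @^-1` [set 1]) = (p%:R^-1)%:E /\
     P (X p @^-1` [set 0]) = (1 - p%:R^-1)%:E).

(* [F] and [G] have the same order of magnitude at +oo (for eventually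
   nonnegative [G]). *)
Definition same_order (R : realType) (F G : R -> R) : Prop :=
  exists a b : R, 0 < a /\ 0 < b /\
    \forall x \near +oo, a * G x <= F x <= b * G x.

(* [F x D ~ G x D] as [x] tends to +oo, uniformly in [D \in S x]. *)
Definition equiv_uniformly (R : realType) (S : R -> set R) (F G : R -> R -> R)
    : Prop :=
  forall e : R, 0 < e -> \forall x \near +oo, forall D : R, S x D ->
    `| F x D - G x D | <= e * `| G x D |.

(* Proportion of integers 1 <= n <= x for which the normalized truncated sum
   is at least [D]. *)
Definition int_tail (R : realType) (f : nat -> R) (x y D : R) : R :=
  (count (fun n => D <= (truncated f n y - meanf f y) / sigmaf f y)
     (iota 1 (Num.truncn x)))%:R / x.

Definition model_tail (d : measure_display) (T : measurableType d)
    (R : realType) (P : probability T R) (X : nat -> {RV P >-> R})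
    (f : nat -> R) (y D : R) : R :=
  fine (P [set w | D * sigmaf f y <=
                   \sum_(p <- primes_upto y) f p * (X p w - p%:R^-1)]).

(* Main.v *)
Require Import Defs.
From HB Require Import structures.
From mathcomp Require Import all_boot all_order all_algebra.
From mathcomp Require Import all_classical all_reals all_analysis.
From mathcomp Require Import measurable_realfun.
From mathcomp Require Import ring lra zify.
Import Order.TTheory GRing.Theory Num.Theory.
Import numFieldNormedType.Exports.

Set Implicit Arguments.
Unset Strict Implicit.
Unset Printing Implicit Defensive.

Local Open Scope classical_set_scope.
Local Open Scope ring_scope.

(** Write [S] for the sum of [f p * X p] over the primes [p <= y].  Both sides
    are tails at the same threshold [thr = D * sigmaf f y + meanf f y]: the left
    one for the value at a uniform integer [n <= x] of the truncated function
    [n |-> sum of f p over p | n, p <= y], the right one for [S].  The two laws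
    are close in absolute terms, and the tail of [S] is not too small; the
    comparison is then a matter of exponents.

    Closeness.  A function [phi] of the truncated sum is a multilinear
    polynomial in the indicators of [p | n], with coefficient at most
    [2 ^ omega(d)] on the indicator of [d | n].  Replacing the indicators by
    independent variables changes the mean over [n <= x] by at most the sum over
    [d] of [2 ^ omega(d)] times the fractional part of [x / d], divided by [x].  Such a
    fractional part is at most [(x / d) ^ (1 - e)] for every [e] in [[0, 1]]
    (Rankin's trick), so that the total error is at most
    [x ^ (- e) * prod_p (1 + 2 * p ^ (e - 1))] (lemma [model_error]).  With
    [e = K / ln y] and [u = ln x / ln y] this is
    [expR (- K * u + 2 * sum 1 / p + O_K(1))] ([model_error_primes_upto]), where
    [K] is a constant at our disposal.  As [u] is at least a constant times
    [ln (ln x)], a large [K] makes the error smaller than any prescribed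
    negative power of [ln x].

    Lower bound for the tail.  For [1 <= D <= c * sigmaf f y] the threshold is
    at most [meanf f y + c * sigmaf f y ^+ 2], which the tail condition of the
    class bounds by a multiple of [ln (ln y)] ([classC_sums]).  On the other hand
    [Psi] vanishes at [0], since [f] is positive on primes, and is right
    continuous; so a positive proportion of the primes satisfy [d < f p] for
    some [d > 0], and the sum of [1 / p] over them is at least a multiple of
    [ln (ln y)] ([classC_sum_inv_large]).  Cutting these primes into as many
    blocks as successes are required, each with a sum of [1 / p] bounded below,
    and asking for a success in every block, shows that [S] reaches the
    threshold with probability at least [(ln x) ^ (- C)] ([model_lower],
    [classC_model_lower]).

    All the sums over primes are measured against harmonic sums
    [H I = 1 + 1 / 2 + ... + 1 / I], where [I] is about [ln y / ln 2]; the
    arithmetic input is Chebyshev's bounds at powers of two. *)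

(** * Chebyshev bounds at powers of two *)

Section chebyshev.
Local Open Scope nat_scope.

Definition nprimes n : nat := count prime (iota 0 n.+1).

Lemma prod_primes_dvd (s : seq nat) N : uniq s -> all prime s ->
  {in s, forall p, p %| N} -> \prod_(p <- s) p %| N.
Proof.
elim: s => [|p s IH] /=; first by rewrite big_nil dvd1n.
move=> /andP[ps us] /andP[pp als] dN; rewrite big_cons Gauss_dvd.
  by rewrite dN ?mem_head // IH // => q qs; rewrite dN // inE qs orbT.
rewrite prime_coprime //; apply: contra ps.
rewrite Euclid_dvd_prod // big_has => /hasP[q qs].
by rewrite /= dvdn_prime2 // => [/eqP ->//|]; apply: (allP als).
Qed.

Lemma nprimes_add m k : nprimes (m + k) = nprimes m + count prime (iota m.+1 k).
Proof. by rewrite /nprimes -addSn iotaD count_cat. Qed.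

Lemma central_binomial_le n : 'C(n.*2, n) <= 4 ^ n.
Proof.
have -> : 4 ^ n = (1 + 1) ^ n.*2 by rewrite -mul2n expnM.
rewrite expnDn (bigD1 (inord n)) //= inordK; last by rewrite ltnS -addnn leq_addr.
by rewrite !exp1n !muln1 leq_addr.
Qed.

Lemma central_binomial_ge n : 2 ^ n <= 'C(n.*2, n).
Proof.
elim: n => [//|n IH]; rewrite doubleS binS expnS.
have -> : 'C(n.*2.+1, n.+1) = 'C(n.*2.+1, n).
  rewrite -bin_sub; last by rewrite ltnS -addnn leq_addr.
  by congr ('C(_, _)); lia.
rewrite addnn -mul2n leq_mul2l /=; apply: leq_trans IH _.
by rewrite leq_bin2l.
Qed.

Lemma prime_dvd_fact p n : prime p -> (p %| n`!) = (p <= n).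
Proof.
move=> pp; apply/idP/idP => [|pn]; last by rewrite dvdn_fact ?prime_gt0.
elim: n => [|n IH]; first by rewrite fact0 Euclid_dvd1.
by rewrite factS Euclid_dvdM // => /orP[/dvdn_leq->//|/IH /leqW].
Qed.

Lemma prime_dvd_central_binomial n p :
  prime p -> n < p <= n.*2 -> p %| 'C(n.*2, n).
Proof.
move=> pp /andP[np p2n].
have nn : n <= n.*2 by rewrite -addnn leq_addr.
have : p %| n.*2`! by rewrite prime_dvd_fact.
rewrite -(bin_fact nn) (_ : n.*2 - n = n); last by lia.
rewrite !Euclid_dvdM // prime_dvd_fact //.
by rewrite leqNgt np /= orbF.
Qed.

(** The primes between [n] and [2 n] all divide [C(2n, n) <= 4 ^ n], so there
    are at most [2 n / log_2 n] of them. *)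
Lemma nprimes_double i : i * nprimes (2 ^ i.+1) <= i * nprimes (2 ^ i) + 2 ^ i.+1.
Proof.
set n := 2 ^ i.
have -> : 2 ^ i.+1 = n + n by rewrite expnS mul2n addnn.
rewrite nprimes_add mulnDr leq_add2l -size_filter.
set s := seq.filter _ _.
have ss p : p \in s -> prime p /\ (n < p <= n.*2).
  by rewrite mem_filter mem_iota => /andP[->]; rewrite -addnn addSn ltnS.
have sP : \prod_(p <- s) p %| 'C(n.*2, n).
  apply: prod_primes_dvd; first by rewrite filter_uniq ?iota_uniq.
    exact: filter_all.
  by move=> p /ss[pp np]; apply: prime_dvd_central_binomial.
rewrite -(@leq_exp2l 2) // addnn.
have -> : 2 ^ n.*2 = 4 ^ n by rewrite -mul2n expnM.
apply: leq_trans (central_binomial_le n); rewrite expnM -/n.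
apply: leq_trans (dvdn_leq _ sP); last by rewrite bin_gt0 -addnn leq_addr.
clear sP; elim: s ss => [|p s IH] ss /=; first by rewrite big_nil.
rewrite big_cons expnS leq_mul //; last by apply: IH => q qs; apply: ss; rewrite inE qs orbT.
by have [_ /andP[/ltnW]] := ss p (mem_head _ _).
Qed.

Lemma nprimes_pow2_le i : i * nprimes (2 ^ i) <= 6 * 2 ^ i.
Proof.
elim: i => [//|i IH]; case: (ltnP i 2) => [|i2]; first by case: i IH => [|[|]].
have := nprimes_double i; have := IH.
rewrite !(expnS _ i).
move: (nprimes (2 * 2 ^ i)) (nprimes (2 ^ i)) (2 ^ i) => a b n H1 H2.
nia.
Qed.

(** In Legendre's formula for [C(2n, n)] each power [p ^ k] contributes
    [2n %/ p ^ k - 2 * (n %/ p ^ k)], which is [0] or [1], and is [0] as soon as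
    [p ^ k] exceeds [2 n]. *)
Lemma logn_central_binomial_le n p : 0 < n -> prime p ->
  p ^ logn p 'C(n.*2, n) <= n.*2.
Proof.
move=> n0 pp; have p1 := prime_gt1 pp.
have nn : n <= n.*2 by rewrite -addnn leq_addr.
have n20 : 0 < n.*2 by rewrite double_gt0.
apply: leq_trans (trunc_logP p1 n20); rewrite leq_exp2l //.
have := congr1 (logn p) (bin_fact nn).
rewrite (_ : n.*2 - n = n); last by lia.
rewrite !lognM ?muln_gt0 ?fact_gt0 ?bin_gt0 // !logn_fact //.
set S := \sum_(1 <= k < n.+1) _; set S2 := \sum_(1 <= k < n.*2.+1) _ => eqS.
suff : S2 <= S + S + trunc_log p n.*2 by lia.
have -> : S = \sum_(1 <= k < n.*2.+1) n %/ p ^ k.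
  rewrite /S (@big_nat_widen _ _ _ 1 n.+1 n.*2.+1) ?ltnS //= big_mkcond /=.
  apply: eq_bigr => k _; case: ltnP => // nk; rewrite divn_small //.
  by apply: leq_trans (ltn_expl _ p1); rewrite ltnW.
have -> : trunc_log p n.*2 = \sum_(1 <= k < n.*2.+1) (k < (trunc_log p n.*2).+1).
  rewrite (eq_bigr (fun k => if k < (trunc_log p n.*2).+1 then 1 else 0)); last first.
    by move=> k _; case: ltnP.
  rewrite -big_mkcond -(@big_nat_widen _ _ _ 1 _ _ predT) ?sum_nat_const_nat ?muln1 ?subn1 //.
  rewrite ltnS; apply: leq_trans (trunc_logP p1 n20); exact/ltnW/ltn_expl.
rewrite -!big_split /=; apply: leq_sum => k _.
have pk0 : 0 < p ^ k by rewrite expn_gt0 prime_gt0.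
rewrite ltnS; case: (leqP k (trunc_log p n.*2)) => kT.
  have : n.*2 %/ p ^ k < (n %/ p ^ k).*2.+2.
    by rewrite ltn_divLR //; have := ltn_ceil n pk0; nia.
  by move: (n.*2 %/ _) (n %/ _) => a b /=; lia.
rewrite divn_small ?addn0 // ltnNge; apply: contraL kT => pkn.
by rewrite -leqNgt trunc_log_max.
Qed.

(** Each prime power in [C(2n, n)] is at most [2 n], so that
    [2 ^ n <= C(2n, n)] forces many primes. *)
Lemma nprimes_pow2_ge i : 0 < i -> 2 ^ i <= 2 * (i * nprimes (2 ^ i)).
Proof.
case: i => [//|i] _; rewrite [in leqLHS]expnS leq_mul2l /=.
set n := 2 ^ i; have n0 : 0 < n by rewrite expn_gt0.
have -> : 2 ^ i.+1 = n.*2 by rewrite expnS mul2n.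
set N := 'C(n.*2, n).
have N0 : 0 < N by rewrite bin_gt0 -addnn leq_addr.
rewrite -(@leq_exp2l 2) //; apply: leq_trans (central_binomial_ge n) _.
rewrite expnM (_ : 2 ^ i.+1 = n.*2); last by rewrite expnS mul2n.
rewrite -/N [leqLHS](prod_prime_decomp N0) prime_decompE big_map /=.
apply: (@leq_trans (\prod_(p <- primes N) n.*2)).
  rewrite big_seq [X in _ <= X]big_seq; apply: leq_prod => p.
  rewrite mem_primes => /and3P[pp _ _]; exact: logn_central_binomial_le.
rewrite big_const_seq count_predT iter_muln_1 leq_exp2l; last by lia.
rewrite /nprimes -size_filter; apply: uniq_leq_size (primes_uniq _) _ => p.
rewrite mem_primes mem_filter mem_iota => /and3P[pp _ pN]; rewrite pp /= add0n ltnS.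
rewrite -prime_dvd_fact //; apply: dvdn_trans pN _.
by rewrite -(bin_fact (_ : n <= n.*2)) ?dvdn_mulr // -addnn leq_addr.
Qed.

End chebyshev.

(** * Dyadic summation over primes *)

Definition primes_le (n : nat) : seq nat := [seq p <- iota 0 n.+1 | prime p].

Lemma size_primes_le n : size (primes_le n) = nprimes n.
Proof. by rewrite size_filter. Qed.

Lemma uniq_primes_le n : uniq (primes_le n).
Proof. by rewrite filter_uniq ?iota_uniq. Qed.

Lemma mem_primes_le n p : (p \in primes_le n) = prime p && (p <= n)%N.
Proof. by rewrite mem_filter mem_iota add0n ltnS. Qed.

Lemma sum_primes_le_narrow (R : realType) (g : nat -> R) m n : (m <= n)%N ->
  \sum_(p <- primes_le m) g p = \sum_(p <- primes_le n | (p <= m)%N) g p.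
Proof.
move=> mn; rewrite !big_filter big_filter_cond.
rewrite -[iota _ m.+1](_ : index_iota 0 m.+1 = _); last by rewrite /index_iota subn0.
rewrite -[iota _ n.+1](_ : index_iota 0 n.+1 = _); last by rewrite /index_iota subn0.
by rewrite (@big_nat_widen _ _ _ _ _ n.+1) // ltnS.
Qed.

(** The geometric sum of [2 ^ - i] over the powers [2 ^ i >= p] is dominated by
    its first term, which lies between [1 / (2 p)] and [1 / p]. *)
Lemma dyadic_weight (R : realType) p I : (1 < p)%N -> (p <= 2 ^ I)%N ->
  p%:R^-1 / 2 <= \sum_(0 <= i < I | (p <= 2 ^ i.+1)%N) (2 ^ i.+1)%:R^-1 :> R
  /\ \sum_(0 <= i < I | (p <= 2 ^ i.+1)%N) (2 ^ i.+1)%:R^-1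
     <= 2 / p%:R - (2 ^ I)%:R^-1 :> R.
Proof.
move=> p1; have p0 : 0 < p%:R :> R by rewrite ltr0n ltnW.
elim: I => [|I IH] pI; first by rewrite expn0 in pI; lia.
rewrite big_mkcond big_nat_recr //= -big_mkcond pI /=.
have a0 : 0 < (2 ^ I)%:R :> R by rewrite ltr0n expn_gt0.
have pa : p%:R <= 2 * (2 ^ I)%:R :> R by rewrite -natrM ler_nat -expnS.
have -> : (2 ^ I.+1)%:R^-1 = (2 ^ I)%:R^-1 / 2 :> R.
  by rewrite expnS natrM invfM mulrC.
have [{}/IH[IH1 IH2]|Ip] := leqP p (2 ^ I).
  have := ltW a0; rewrite -invr_ge0 => ai0; split; lra.
rewrite big_nat_cond big1 ?add0r; last first.
  move=> i /andP[/andP[_ iI] pi].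
  by move: (leq_trans pi (leq_pexp2l (isT : 0 < 2)%N iI)); rewrite leqNgt Ip.
have ap : (2 ^ I)%:R <= p%:R :> R by rewrite ler_nat ltnW.
have h1 : p%:R^-1 <= (2 ^ I)%:R^-1 :> R by rewrite lef_pV2.
have h2 : (2 ^ I)%:R^-1 <= 2 / p%:R :> R.
  by rewrite ler_pdivlMr // mulrC ler_pdivrMr.
split; lra.
Qed.

(** Partial summation along powers of two: it turns bounds on the summatory
    function of [g] over primes into bounds on the sum of [g p / p]. *)
Lemma dyadic_sum (R : realType) (g : nat -> R) I : (forall p, prime p -> 0 <= g p) ->
  \sum_(p <- primes_le (2 ^ I)) g p / p%:R
    <= 2 * \sum_(0 <= i < I) (\sum_(p <- primes_le (2 ^ i.+1)) g p) / (2 ^ i.+1)%:R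
  /\ \sum_(0 <= i < I) (\sum_(p <- primes_le (2 ^ i.+1)) g p) / (2 ^ i.+1)%:R
    <= 2 * \sum_(p <- primes_le (2 ^ I)) g p / p%:R.
Proof.
move=> g0.
have -> : \sum_(0 <= i < I) (\sum_(p <- primes_le (2 ^ i.+1)) g p) / (2 ^ i.+1)%:R
  = \sum_(p <- primes_le (2 ^ I)) g p *
     \sum_(0 <= i < I | (p <= 2 ^ i.+1)%N) (2 ^ i.+1)%:R^-1.
  transitivity (\sum_(0 <= i < I) \sum_(p <- primes_le (2 ^ I))
      if (p <= 2 ^ i.+1)%N then g p / (2 ^ i.+1)%:R else 0).
    rewrite big_nat [RHS]big_nat; apply: eq_bigr => i /andP[_ iI].
    by rewrite (@sum_primes_le_narrow _ _ _ (2 ^ I)) ?leq_exp2l // mulr_suml big_mkcond.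
  rewrite exchange_big; apply: eq_bigr => p _.
  by rewrite -big_mkcond mulr_sumr.
have H p : p \in primes_le (2 ^ I) -> prime p /\ (p <= 2 ^ I)%N.
  by rewrite mem_primes_le => /andP.
rewrite !mulr_sumr; split; rewrite big_seq [leRHS]big_seq; apply: ler_sum => p /H[pp pI];
  have [h1 h2] := @dyadic_weight R p I (prime_gt1 pp) pI; rewrite mulrCA ler_wpM2l ?g0 //.
- lra.
- by apply: le_trans h2 _; rewrite gerBl invr_ge0 ler0n.
Qed.

Lemma ln_harmonic (R : realType) I :
  ln I.+1%:R <= series (@harmonic R) I /\ series (@harmonic R) I.+1 <= 1 + ln I.+1%:R.
Proof.
rewrite /series /harmonic /=; split; elim: I => [|I IH].
- by rewrite ln1 big_geq.
- rewrite big_nat_recr //=.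
  have -> : I.+2%:R = I.+1%:R * (1 + I.+1%:R^-1) :> R.
    by rewrite mulrDr mulr1 divff ?pnatr_eq0 // natr1.
  have i0 : 0 < I.+1%:R^-1 :> R by rewrite invr_gt0 ltr0n.
  have i1 : 0 < 1 + I.+1%:R^-1 :> R by rewrite addr_gt0.
  rewrite lnM ?posrE ?ltr0n //.
  by rewrite lerD // le_ln1Dx // (lt_trans _ i0) ?ltrN10.
- by rewrite big_nat1 ln1 invr1 addr0.
- rewrite big_nat_recr //=.
  have -> : ln I.+2%:R = ln (I.+1%:R / (1 + - I.+2%:R^-1)) :> R.
    congr ln.
    have n0 : I.+2%:R != 0 :> R by rewrite pnatr_eq0.
    have -> : 1 - I.+2%:R^-1 = I.+1%:R / I.+2%:R :> R.
      by apply: (mulIf n0); rewrite mulrBl mul1r mulVf // divfK // -natr1 addrK.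
    by rewrite invf_div mulrCA divff ?mulr1 // pnatr_eq0.
  have i0 : I.+2%:R^-1 < 1 :> R by rewrite invf_lt1 ?ltr0n // ltr1n.
  have i1 : 0 < 1 - I.+2%:R^-1 :> R by rewrite subr_gt0.
  rewrite ln_div ?posrE ?ltr0n //.
  have := @le_ln1Dx R (- I.+2%:R^-1); rewrite ltrN2 => /(_ i0).
  by move: (I.+2%:R^-1) (ln (1 - _)) IH => t u IH ut; lra.
Qed.

(** * Additive functions of an integer against the independent model *)

(** The expectation of [phi (t + S)], where [S] is the sum over [p] in [s] of
    [f p] times independent Bernoulli variables of parameters [1 / p]; the
    recursion conditions on the first variable. *)
Fixpoint model_mean (R : realType) (f : nat -> R) (phi : R -> R) (s : seq nat) (t : R) : R :=
  if s is p :: s' then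
    (1 - p%:R^-1) * model_mean f phi s' t + p%:R^-1 * model_mean f phi s' (t + f p)
  else phi t.

(** The bounds by [r] when [r < 1] and by [1] when [1 <= r] both interpolate to
    a power of [r] of exponent at most [1]. *)
Lemma fractional_part_le_powR (R : realType) (r e : R) (k : nat) : 0 <= e <= 1 -> 0 < r ->
  k%:R <= r < k.+1%:R -> `|k%:R - r| <= r `^ (1 - e).
Proof.
move=> /andP[e0 e1] r0 /andP[kr rk]; rewrite distrC ger0_norm ?subr_ge0 //.
case: k kr rk => [|k] kr rk.
  rewrite subr0 -[leLHS](powRr1 (ltW r0)).
  have rr : 0 < r <= 1 by rewrite r0 ltW.
  by apply: (ger_powR rr); rewrite gerBl.
apply: (@le_trans _ _ 1); first by rewrite lerBlDl natr1 ltW.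
rewrite -[leLHS](powRr0 r); apply: ler_powR; last by rewrite subr_ge0.
by apply: le_trans kr; rewrite ler1n.
Qed.

(** The induction peels off one prime: the terms with [p %| m] are counted with
    the modulus [q * p], so the error obeys [err (p :: s) q <= err s q + 2 err s
    (q p)].  This is the recursion satisfied by the bound, because
    [(x / (q p)) ^ (1 - e)] is [(x / q) ^ (1 - e) * p ^ (e - 1)]; the modulus
    [q] and the shift [t] are generalized for that purpose. *)
Lemma model_error (R : realType) (f : nat -> R) (phi : R -> R) (x e : R) :
  (forall t, `|phi t| <= 1) -> 0 <= e <= 1 -> 0 < x ->
  forall (s : seq nat) (q : nat) (t : R), uniq s -> all prime s -> (0 < q)%N ->
  all (coprime q) s ->
  `| \sum_(1 <= m < (Num.truncn x).+1 | (q %| m)%N) phi (t + \sum_(p <- s | (p %| m)%N) f p)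
     - x / q%:R * model_mean f phi s t |
  <= (x / q%:R) `^ (1 - e) * \prod_(p <- s) (1 + 2 * p%:R `^ (e - 1)).
Proof.
move=> phi1 e01 x0; elim=> [|p s IH] q t us ps q0 cs.
  have -> : \sum_(1 <= m < (Num.truncn x).+1 | (q %| m)%N)
      phi (t + \sum_(p <- [::] | (p %| m)%N) f p) = (Num.truncn x %/ q)%:R * phi t.
    rewrite divn_count_dvd natr_sum mulr_suml big_mkcond; apply: eq_bigr => m _.
    by rewrite big_nil addr0; case: (q %| m)%N; rewrite ?mul1r ?mul0r.
  rewrite big_nil mulr1 /= -mulrBl normrM.
  apply: le_trans (ler_piMr (normr_ge0 _) (phi1 _)) _.
  have qR : 0 < q%:R :> R by rewrite ltr0n.
  apply: fractional_part_le_powR => //; first by rewrite divr_gt0.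
  have /andP[N1 N2] := truncn_itv (ltW x0).
  rewrite ler_pdivlMr // ltr_pdivrMr // -!natrM; apply/andP; split.
    by apply: le_trans N1; rewrite ler_nat leq_trunc_div.
  by apply: lt_le_trans N2 _; rewrite ler_nat ltn_ceil.
have [/andP[psn {}us] /andP[pp {}ps] /andP[qp {}cs]] := And3 us ps cs.
have p0 := prime_gt0 pp; have pR : 0 < p%:R :> R by rewrite ltr0n.
have qR : 0 < q%:R :> R by rewrite ltr0n.
have qps : all (coprime (q * p)) s.
  apply/allP => r rs; rewrite coprimeMl (allP cs) // prime_coprime // dvdn_prime2 //.
    by apply: contra psn => /eqP ->.
  exact: (allP ps).
have qp0 : (0 < q * p)%N by rewrite muln_gt0 q0.
set S := fun q s t => \sum_(1 <= m < (Num.truncn x).+1 | (q %| m)%N)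
  phi (t + \sum_(p <- s | (p %| m)%N) f p).
have -> : \sum_(1 <= m < (Num.truncn x).+1 | (q %| m)%N)
  phi (t + \sum_(p <- (p :: s) | (p %| m)%N) f p) =
  S q s t + (S (q * p)%N s (t + f p) - S (q * p)%N s t).
  rewrite /S -sumrB big_mkcond [X in _ = X + _]big_mkcond [X in _ = _ + X]big_mkcond.
  rewrite -big_split; apply: eq_bigr => m _ /=.
  rewrite Gauss_dvd // big_cons; case: (q %| m)%N => /=; last by rewrite addr0.
  by case: (p %| m)%N; rewrite ?addr0 // addrA [RHS]addrC subrK.
rewrite big_cons.
have IH1 := IH q t us ps q0 cs.
have IH2 := IH (q * p)%N (t + f p) us ps qp0 qps.
have IH3 := IH (q * p)%N t us ps qp0 qps.
rewrite -/(S _ _ _) in IH1 IH2 IH3.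
have E : (x / (q * p)%:R) `^ (1 - e) = (x / q%:R) `^ (1 - e) * p%:R `^ (e - 1).
  rewrite natrM invfM mulrA powRM ?divr_ge0 ?invr_ge0 ?ltW // -(powR_inv1 (ltW pR)) -powRrM.
  by congr (_ * _ `^ _); ring.
have E' : x / (q * p)%:R = x / q%:R / p%:R by rewrite natrM invfM mulrA.
rewrite {}E {}E' in IH2 IH3.
have -> : forall a b c m m' : R, a + (b - c) - x / q%:R * ((1 - p%:R^-1) * m + p%:R^-1 * m') =
   (a - x / q%:R * m) + (b - x / q%:R / p%:R * m') - (c - x / q%:R / p%:R * m).
  by move=> *; ring.
apply: le_trans (ler_normB _ _) _; rewrite mulrDl mul1r mulrDr.
apply: le_trans (lerD (le_trans (ler_normD _ _) (lerD IH1 IH2)) IH3) _.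
rewrite -addrA lerD2l -mulrDl le_eqVlt; apply/orP; left; apply/eqP.
ring.
Qed.

(** * A lower bound for the tail of the model *)

Section model_bounds.
Variables (R : realType) (f : nat -> R) (thr : R).
Hypothesis f0 : forall p, prime p -> 0 <= f p.
Let phi (t : R) : R := (thr <= t)%R%:R.
Let M := model_mean f phi.

Lemma inv_prime_itv p : prime p -> 0 <= p%:R^-1 :> R /\ p%:R^-1 <= 1 :> R.
Proof.
move=> pp; rewrite invr_ge0 ler0n; split=> //.
by rewrite invf_le1 ?ltr0n ?ler1n ?prime_gt0.
Qed.

Lemma model_itv s t : all prime s -> 0 <= M s t <= 1.
Proof.
rewrite /M; elim: s t => [|p s IH] t /=; first by rewrite /phi; case: (thr <= t); rewrite ?ler01 ?lexx.
move=> /andP[/inv_prime_itv[w0 w1] ps].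
have /andP[a0 a1] := IH t ps; have /andP[b0 b1] := IH (t + f p) ps.
move: (model_mean _ _ _ _) (model_mean _ _ _ _) (p%:R^-1) a0 a1 b0 b1 w0 w1 => a b w *.
by apply/andP; split; nra.
Qed.

Lemma model_mono s t t' : all prime s -> t <= t' -> M s t <= M s t'.
Proof.
rewrite /M; elim: s t t' => [|p s IH] t t' /=.
  by move=> _ tt'; rewrite /phi; case: (lerP thr t) => // h; rewrite (le_trans h tt').
move=> /andP[/inv_prime_itv[w0 w1] ps] tt'.
by rewrite lerD // ler_wpM2l ?subr_ge0 // IH // lerD2r.
Qed.

Lemma model_ge_phi s t : all prime s -> phi t <= M s t.
Proof.
rewrite /M; elim: s t => [|p s IH] t //= /andP[pp ps].
have [w0 w1] := inv_prime_itv pp.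
have h1 := IH t ps; have h2 : phi t <= model_mean f phi s (t + f p).
  by apply: le_trans h1 (model_mono ps _); rewrite lerDl f0.
nra.
Qed.

(** Here [j] full blocks of weight [2 * eta] remain to be filled after the
    current one, of which the weight [r] is left; [Q] selects the primes whose
    success counts.  As a single prime weighs at most [eta], a block contains
    primes of total weight at least [eta] before it is exhausted, and has a
    success with probability at least [1 - expR (- eta)].  The bound is trivial
    once [r <= eta], which is how a block ends. *)
Lemma model_lower_partial_block (Q : pred nat) (d eta : R) :
  (forall p, prime p -> Q p -> d <= f p /\ p%:R^-1 <= eta) -> 0 <= eta ->
  forall s j r t, all prime s -> j%:R * (2 * eta) + r <= \sum_(p <- s | Q p) p%:R^-1 ->
  r <= 2 * eta -> thr - t <= j.+1%:R * d ->
  (1 - expR (eta - r)) * (1 - expR (- eta)) ^+ j <= M s t.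
Proof.
move=> HQ eta0; have rho0 : 0 <= 1 - expR (- eta) by rewrite subr_ge0 expR_le1 oppr_le0.
elim=> [|p s IH] j r t ps Hsum r2 Ht.
- apply: (@le_trans _ _ 0); last by have /andP[] := @model_itv [::] t ps.
  rewrite mulr_le0_ge0 ?exprn_ge0 // subr_le0 -expR0 ler_expR subr_ge0.
  have := mulr_ge0 (ler0n R j) eta0; move: Hsum; rewrite big_nil; nra.
have [rle|rgt] := leP r eta.
  apply: (@le_trans _ _ 0); last by have /andP[] := @model_itv (p :: s) t ps.
  by rewrite mulr_le0_ge0 ?exprn_ge0 // subr_le0 -expR0 ler_expR subr_ge0.
have /andP[pp ps'] := ps.
have [w0 w1] := inv_prime_itv pp.
rewrite /M /= -/M; move: Hsum; rewrite big_cons.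
case: ifPn => [Qp|_] Hsum; last first.
  have := IH j r t ps' Hsum r2 Ht.
  have : M s t <= M s (t + f p) by apply: model_mono => //; rewrite lerDl f0.
  nra.
have [dp wp] := HQ p pp Qp.
have H1 : (1 - expR (eta - r) * expR p%:R^-1) * (1 - expR (- eta)) ^+ j <= M s t.
  have := IH j (r - p%:R^-1) t ps'.
  rewrite (_ : eta - (r - p%:R^-1) = eta - r + p%:R^-1) ?expRD; last by ring.
  by apply=> //; lra.
have H2 : (1 - expR (- eta)) ^+ j <= M s (t + f p).
  case: j Ht Hsum {H1} => [|j] Ht Hsum.
    rewrite expr0; apply: le_trans (model_ge_phi _ ps').
    by rewrite /phi (_ : thr <= t + f p) //; lra.
  have := IH j (2 * eta) (t + f p) ps'.
  rewrite (_ : eta - 2 * eta = - eta); last by ring.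
  rewrite -exprS; apply=> //.
    by move: Hsum; rewrite -natr1; nra.
  by move: Ht; rewrite -natr1; nra.
(* A failure at [p] costs the factor [1 - 1 / p], which the weight [1 / p]
   withdrawn from the block compensates. *)
have E1 : (1 - p%:R^-1) * expR p%:R^-1 <= 1 :> R.
  apply: le_trans (ler_wpM2r (expR_ge0 _) (expR_ge1Dx _)) _.
  by rewrite mulrC expRxMexpNx_1.
have r0 : 0 <= (1 - expR (- eta)) ^+ j by rewrite exprn_ge0.
have E0 := expR_ge0 (eta - r).
have w1' : 0 <= 1 - p%:R^-1 :> R by rewrite subr_ge0.
apply: le_trans (lerD (ler_wpM2l w1' H1) (ler_wpM2l w0 H2)).
rewrite mulrA -mulrDl ler_wpM2r //.
rewrite mulrBr mulr1 mulrCA.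
have := ler_wpM2l E0 E1; lra.
Qed.

Lemma model_lower (Q : pred nat) (d eta : R) (s : seq nat) j t :
  (forall p, prime p -> Q p -> d <= f p /\ p%:R^-1 <= eta) -> 0 <= eta ->
  all prime s -> j%:R * (2 * eta) <= \sum_(p <- s | Q p) p%:R^-1 ->
  thr - t <= j%:R * d -> (1 - expR (- eta)) ^+ j <= M s t.
Proof.
move=> HQ eta0 ps; case: j => [|j] Hs Ht.
  rewrite expr0; apply: le_trans (model_ge_phi _ ps).
  by rewrite /phi (_ : thr <= t) //; lra.
have := @model_lower_partial_block Q d eta HQ eta0 s j (2 * eta) t ps.
rewrite (_ : eta - 2 * eta = - eta) -?exprS; last by ring.
by apply=> //; move: Hs; rewrite -natr1; lra.
Qed.
End model_bounds.

(** * The model as a law of the random variables *)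

Section model_probability.
Variables (d : measure_display) (T : measurableType d) (R : realType).
Variables (P : probability T R) (X : nat -> {RV P >-> R}).
Variable f : nat -> R.

Lemma measurable_weighted_tail (s : seq nat) (t thr : R) :
  measurable [set w | thr <= t + \sum_(p <- s) f p * X p w].
Proof.
have mg : measurable_fun setT (fun w => t + \sum_(p <- s) f p * X p w).
  apply: measurable_funD; first exact: measurable_cst.
  by apply: measurable_sum => p; apply: measurable_funM; first exact: measurable_cst.
have := mg measurableT `[thr, +oo[%classic (measurable_itv _).
rewrite setTI; congr measurable; apply/seteqP; split => w /=; by rewrite in_itv/= andbT.
Qed.

Lemma measurable_RV_preimage p (B : set R) : measurable B -> measurable (X p @^-1` B).
Proof. by move=> mB; rewrite -[X in measurable X]setTI; exact: measurable_funP. Qed.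

(** [X p] takes the values [0] and [1] almost surely, but not necessarily
    everywhere. *)
Lemma bernoulli_split p (A : set T) : bernoulli_primes X -> prime p -> measurable A ->
  P A = (P (A `&` X p @^-1` [set 0%R]) + P (A `&` X p @^-1` [set 1%R]))%E.
Proof.
move=> [_ hb] pp mA; have [h1 h0] := hb p pp.
have m0 := measurable_RV_preimage p (measurable_set1 (0 : R)).
have m1 := measurable_RV_preimage p (measurable_set1 (1 : R)).
have dis : X p @^-1` [set 0] `&` X p @^-1` [set 1] = set0 :> set T.
  apply/seteqP; split => w //= [-> /esym/eqP]; by rewrite oner_eq0.
have mU := measurableU _ _ m0 m1.
have PU : P (X p @^-1` [set 0] `|` X p @^-1` [set 1]) = 1%E.
  rewrite measureU //; apply: etrans (congr2 _ h0 h1) _.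
  by rewrite -EFinD; congr EFin; ring.
have Pc : P (~` (X p @^-1` [set 0] `|` X p @^-1` [set 1])) = 0%E.
  by rewrite probability_setC // PU subee.
rewrite -[A in LHS](setIT A) -(setUv (X p @^-1` [set 0] `|` X p @^-1` [set 1])) setIUr.
have mUC := measurableC mU.
have mAU := measurableI _ _ mA mU; have mAC := measurableI _ _ mA mUC.
have dis2 := etrans (setIACA A (X p @^-1` [set 0] `|` X p @^-1` [set 1]) A _)
  (etrans (congr1 (setI (A `&` A)) (setICr _)) (setI0 (A `&` A))).
rewrite (measureU P mAU mAC dis2).
have dis3 := etrans (setIACA A (X p @^-1` [set 0]) A (X p @^-1` [set 1]))
  (etrans (congr1 (setI (A `&` A)) dis) (setI0 (A `&` A))).
have PAU : P (A `&` (X p @^-1` [set 0] `|` X p @^-1` [set 1])) =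
    (P (A `&` X p @^-1` [set 0%R]) + P (A `&` X p @^-1` [set 1%R]))%E.
  by rewrite setIUr (measureU P (measurableI _ _ mA m0) (measurableI _ _ mA m1) dis3).
suff PAC : P (A `&` ~` (X p @^-1` [set 0] `|` X p @^-1` [set 1])) = 0%E.
  exact: etrans (congr2 _ PAU PAC) (adde0 _).
by apply/eqP; rewrite -measure_le0 -Pc le_measure ?inE.
Qed.

(** The events [X i \in B i] for [i] in [s'] record the values already revealed;
    carrying them along lets the induction use the product rule only once, when
    [s] is exhausted. *)
Lemma model_tail_conditioned (thr : R) : bernoulli_primes X ->
  forall (s s' : seq nat) (B : nat -> set R) (t : R), uniq (s' ++ s) -> all prime (s' ++ s) ->
  (forall i, measurable (B i)) ->
  P (\bigcap_(i in [set` s']) (X i @^-1` B i) `&` [set w | thr <= t + \sum_(p <- s) f p * X p w])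
  = ((\prod_(i <- s') P (X i @^-1` B i)) * (model_mean f (fun t => (thr <= t)%R%:R) s t)%:E)%E.
Proof.
move=> hX; have [hind hb] := hX; elim=> [|p s IH] s' B t us ps mB.
  rewrite !cats0 in us ps.
  rewrite [X in _ `&` X](_ : _ = if thr <= t then setT else set0); last first.
    by apply/seteqP; split => w /=; rewrite big_nil addr0; case: ifP.
  case: ifP => tt /=.
    by rewrite setIT tt mule1 hind.
  by rewrite setI0 measure0 tt mule0.
have pp : prime p by move: ps; rewrite all_cat /= => /and3P[].
have [h1 h0] := hb p pp.
have mcap : measurable (\bigcap_(i in [set` s']) (X i @^-1` B i)).
  by apply: fin_bigcap_measurable => [|i _]; [exact: finite_seq|exact: measurable_RV_preimage].
rewrite (bernoulli_split hX pp); last first.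
  by apply: measurableI => //; exact: measurable_weighted_tail.
(* Revealing [X p = b] moves [p] from [s] to [s'] and shifts [t] by [f p * b]. *)
have step b : (\bigcap_(i in [set` s']) (X i @^-1` B i) `&`
    [set w | thr <= t + \sum_(q <- p :: s) f q * X q w] `&` X p @^-1` [set b]) =
  (\bigcap_(i in [set` p :: s']) (X i @^-1` (if i == p then [set b] else B i))) `&`
  [set w | thr <= (t + f p * b) + \sum_(q <- s) f q * X q w].
  apply/seteqP; split => w.
    move=> [[/= h1' h2] h3]; split => /=.
      move=> i /=; rewrite inE => /orP[/eqP -> |is']; first by rewrite eqxx.
      case: eqP => [->//|_]; exact: h1'.
    by move: h2; rewrite big_cons h3 addrA.
  move=> [/= h1' h2].
  have h3 : X p w = b by have := h1' p; rewrite /= mem_head eqxx; apply.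
  split => //; split => /=; last by rewrite big_cons h3 addrA.
  move=> i /= is'; have := h1' i; rewrite /= inE is' orbT => /(_ isT).
  case: eqP is' => // -> ps'.
  by move: us; rewrite cat_uniq /= => /and3P[_ /norP[]]; rewrite ps'.
have pc : perm_eq (s' ++ p :: s) ((p :: s') ++ s) by rewrite -(cat1s p s) perm_catCA.
have us2 : uniq ((p :: s') ++ s) by rewrite -(perm_uniq pc).
have ps2 : all prime ((p :: s') ++ s) by rewrite -(perm_all _ pc).
have ps' : p \notin s' by move: us2 => /= /andP[]; rewrite mem_cat negb_or => /andP[].
have prodE b : (\prod_(i <- p :: s') P (X i @^-1` (if i == p then [set b] else B i)) =
    P (X p @^-1` [set b]) * \prod_(i <- s') P (X i @^-1` B i))%E.
  rewrite big_cons eqxx; congr (_ * _)%E; rewrite big_seq [RHS]big_seq.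
  by apply: eq_bigr => i is'; case: eqP is' => // -> is'; rewrite is' in ps'.
have mB2 b : forall i, measurable (if i == p then [set b] else B i : set R).
  by move=> i; case: ifP => _ //; exact: measurable_set1.
rewrite !step (IH _ _ _ us2 ps2 (mB2 0)) (IH _ _ _ us2 ps2 (mB2 1)) !prodE h0 h1 mulr0 addr0 mulr1.
set A := (\prod_(i <- s') _)%E.
have Af : A \is a fin_num.
  by rewrite /A; apply: prode_fin_num => i _; rewrite fin_num_measure //; exact: measurable_RV_preimage.
rewrite -(fineK Af) /= -!EFinM -EFinD; congr EFin; ring.
Qed.

Lemma model_tailE (y D : R) : bernoulli_primes X ->
  model_tail X f y D = model_mean f (fun t => (D * sigmaf f y + meanf f y <= t)%R%:R) (primes_upto y) 0.
Proof.
move=> hX; rewrite /model_tail.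
have us : uniq ([::] ++ primes_upto y) by rewrite filter_uniq ?iota_uniq.
have ps : all prime ([::] ++ primes_upto y) by exact: filter_all.
have := @model_tail_conditioned (D * sigmaf f y + meanf f y) hX _ [::] (fun=> setT) 0 us ps.
rewrite big_nil mul1e => H.
rewrite -[RHS]/(fine (EFin _)) -H //; congr (fine (P _)).
have sumE w : \sum_(p <- primes_upto y) f p * (X p w - p%:R^-1) =
    \sum_(p <- primes_upto y) f p * X p w - meanf f y.
  by rewrite /meanf -sumrB; apply: eq_bigr => p _; rewrite mulrBr.
apply/seteqP; split => w /=; rewrite sumE add0r lerBrDr => h; last by case: h.
by split.
Qed.

Lemma int_tailE (x y D : R) : 0 < sigmaf f y ->
  int_tail f x y D = x^-1 * \sum_(1 <= m < (Num.truncn x).+1 | (1 %| m)%N)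
    (D * sigmaf f y + meanf f y <= 0 + \sum_(p <- primes_upto y | (p %| m)%N) f p)%R%:R.
Proof.
move=> s0; rewrite /int_tail mulrC; congr (_ * _).
rewrite -sum1_count natr_sum big_mkcond [RHS]big_mkcond /index_iota subn1.
by apply: eq_bigr => m _; rewrite dvd1n ler_pdivlMr // lerBrDr add0r /truncated; case: ifP.
Qed.

End model_probability.

(** * Moments of f over primes *)

Section class_estimates.
Variables (R : realType) (f : nat -> R).
Hypothesis hf : classC f.

(** The square of the number of [j <= a] is a sum of odd numbers: this writes
    [f p ^+ 2] in terms of the events [j <= f p]. *)
Lemma sqr_le_sum_odd (a : R) J : 0 <= a -> a < J%:R ->
  a ^+ 2 <= \sum_(0 <= j < J | j%:R <= a) (2 * j%:R + 1).
Proof.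
move=> a0 aJ; have /andP[k1 k2] := truncn_itv a0; set k := Num.truncn a in k1 k2.
have kJ : (k.+1 <= J)%N by rewrite -(ltr_nat R); apply: le_lt_trans aJ.
have -> : \sum_(0 <= j < J | j%:R <= a) (2 * j%:R + 1) = \sum_(0 <= j < k.+1) (2 * j%:R + 1) :> R.
  rewrite [RHS](@big_nat_widen _ _ _ _ _ J) //; apply: eq_bigl => j.
  by rewrite ltnS /k truncn_ge_nat.
have -> : \sum_(0 <= j < k.+1) (2 * j%:R + 1) = k.+1%:R ^+ 2 :> R.
  elim: (k.+1) => [|n IH]; first by rewrite big_geq // expr0n.
  by rewrite big_nat_recr //= IH -natr1; ring.
by rewrite lerXn2r ?nnegrE // ltW.
Qed.

Lemma sum_odd_geometric J : \sum_(0 <= j < J) (2 * j%:R + 1) * (4 ^+ j)^-1 <= 4 - 4 / 2 ^+ J :> R.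
Proof.
elim: J => [|J IH]; first by rewrite big_geq // expr0 divr1 subrr.
rewrite big_nat_recr //=; apply: le_trans (lerD IH (lexx _)) _.
have : J.+1%:R <= 2 ^+ J :> R by rewrite -natrX ler_nat ltn_expl.
have -> : 4 ^+ J = 2 ^+ J * 2 ^+ J :> R by rewrite -exprMn; congr (_ ^+ _); ring.
rewrite exprS -natr1; have : 0 < 2 ^+ J :> R by rewrite exprn_gt0.
move: (2 ^+ J) => b b0 hJ.
rewrite -subr_ge0 (_ : _ - _ = (2 * b - 2 * J%:R - 1) / (b * b)); last by field; rewrite gt_eqF.
by rewrite divr_ge0 ?mulr_ge0 ?ltW //; lra.
Qed.

(** The tail condition with [A = ln 4] beats the growth of the odd weights. *)
Lemma classC_second_moment : exists2 C : R, 0 <= C &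
  forall i, \sum_(p <- primes_le (2 ^ i.+1)) f p ^+ 2 <= C * (nprimes (2 ^ i.+1))%:R.
Proof.
have f0 := classC_pos hf.
have l4 : 0 < ln 4 :> R by rewrite ln_gt0 // (_ : 1 = 1%:R) // ltr_nat.
have [C HC] := classC_tail hf l4.
have C0 : 0 <= C.
  have := HC 0 2 (lexx _) (lexx _); rewrite mulr0 expR0 mulr1.
  by apply: le_trans; rewrite divr_ge0.
exists (C * 4) => [|i]; first by rewrite mulr_ge0.
set s := primes_le _; have sp p : p \in s -> prime p by rewrite mem_primes_le => /andP[].
(* Any cutoff above the finitely many values [f p] makes the sum over [j]
   finite. *)
set J := (\max_(p <- s) Num.truncn (f p)).+1.
have fJ p : p \in s -> f p < J%:R.
  move=> ps; apply: lt_le_trans (truncnS_gt _) _; rewrite ler_nat ltnS.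
  exact: (@leq_bigmax_seq _ _ _ (fun p => Num.truncn (f p))).
apply: (@le_trans _ _ (\sum_(p <- s) \sum_(0 <= j < J | j%:R <= f p) (2 * j%:R + 1))).
  rewrite big_seq [leRHS]big_seq; apply: ler_sum => p ps.
  by apply: sqr_le_sum_odd; [rewrite ltW // f0 // sp|exact: fJ].
have -> : \sum_(p <- s) \sum_(0 <= j < J | j%:R <= f p) (2 * j%:R + 1) =
  \sum_(0 <= j < J) (2 * j%:R + 1) * (count (fun p => j%:R <= f p) s)%:R :> R.
  under eq_bigr do rewrite big_mkcond.
  rewrite exchange_big; apply: eq_bigr => j _.
  by rewrite -big_mkcond -sum1_count natr_sum mulr_sumr; apply: eq_bigr => p _; rewrite mulr1.
have x2 : 2 <= (2 ^ i.+1)%:R :> R by rewrite ler_nat expnS leq_pmulr // expn_gt0.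
have sE : primes_upto ((2 ^ i.+1)%:R : R) = s by rewrite /primes_upto natrK.
have n0 : 0 < (nprimes (2 ^ i.+1))%:R :> R.
  rewrite ltr0n -size_primes_le -/s lt0n; apply/eqP => /size0nil s0.
  have : 2 \in s by rewrite mem_primes_le /= expnS leq_pmulr // expn_gt0.
  by rewrite s0.
apply: (@le_trans _ _ (\sum_(0 <= j < J) (2 * j%:R + 1) * (4 ^+ j)^-1 * (C * (nprimes (2 ^ i.+1))%:R))).
  apply: ler_sum => j _; rewrite -mulrA ler_wpM2l ?addr_ge0 ?mulr_ge0 //.
  have := HC j%:R _ (ler0n R j) x2.
  rewrite /prime_count /primepi sE size_primes_le ler_pdivrMr // => h.
  have E : expR (- ln 4 * j%:R) = (4 ^+ j)^-1 :> R.
    by rewrite mulNr expRN expRM_natr lnK // posrE ltr0n.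
  by apply: le_trans h _; rewrite E le_eqVlt; apply/orP; left; apply/eqP; ring.
rewrite -mulr_suml (_ : C * 4 * _ = 4 * (C * (nprimes (2 ^ i.+1))%:R)); last by ring.
rewrite ler_wpM2r ?mulr_ge0 //.
apply: le_trans (sum_odd_geometric J) _.
by rewrite gerBl divr_ge0 // exprn_ge0.
Qed.
End class_estimates.

(** * Harmonic size of the sums over primes *)

Section sums_over_primes.
Variable R : realType.
Notation H := (series (@harmonic R)).

Lemma nprimes_density i : 2^-1 / i.+1%:R <= (nprimes (2 ^ i.+1))%:R / (2 ^ i.+1)%:R :> R
  /\ (nprimes (2 ^ i.+1))%:R / (2 ^ i.+1)%:R <= 6 / i.+1%:R :> R.
Proof.
have p0 : 0 < (2 ^ i.+1)%:R :> R by rewrite ltr0n expn_gt0.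
split.
  rewrite ler_pdivlMr // mulrAC ler_pdivrMr // ler_pdivrMl // -!natrM ler_nat.
  by rewrite [X in (_ * X)%N]mulnC nprimes_pow2_ge.
by rewrite ler_pdivrMr // mulrAC ler_pdivlMr // -!natrM ler_nat mulnC nprimes_pow2_le.
Qed.

(** A function bounded on average over the primes has [sum g p / p] of the order
    of [sum 1 / p]. *)
Lemma sum_over_primes_le_harmonic (g : nat -> R) (C : R) I :
  (forall p, prime p -> 0 <= g p) -> 0 <= C ->
  (forall i, \sum_(p <- primes_le (2 ^ i.+1)) g p <= C * (nprimes (2 ^ i.+1))%:R) ->
  \sum_(p <- primes_le (2 ^ I)) g p / p%:R <= 12 * C * H I.
Proof.
move=> g0 C0 HC; have [h _] := dyadic_sum I g0; apply: le_trans h _.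
rewrite (_ : 12 * C * H I = 2 * (6 * C * H I)); last by ring.
rewrite ler_wpM2l // /series mulr_sumr; apply: ler_sum => i _.
apply: (@le_trans _ _ (C * (nprimes (2 ^ i.+1))%:R / (2 ^ i.+1)%:R)).
  by rewrite ler_wpM2r ?invr_ge0 ?ler0n // HC.
rewrite -mulrA (mulrC 6) -mulrA ler_wpM2l // /harmonic.
by have [_] := nprimes_density i.
Qed.

Lemma sum_inv_primes_le I : \sum_(p <- primes_le (2 ^ I)) p%:R^-1 <= 12 * H I.
Proof.
have := @sum_over_primes_le_harmonic (fun=> 1) 1 I (fun _ _ => ler01) ler01.
rewrite mulr1; under eq_bigr do rewrite mul1r; apply=> i.
by rewrite mul1r -size_primes_le -sum1_size natr_sum.
Qed.

Lemma sum_ln_primes_le I : \sum_(p <- primes_le (2 ^ I)) ln p%:R / p%:R <= 12 * ln 2 * I%:R :> R.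
Proof.
have l2 : 0 <= ln 2 :> R by rewrite ln_ge0 // (_ : 1 = 1%:R) // ler_nat.
have [|h _] := @dyadic_sum R (fun p => ln p%:R) I.
  by move=> p pp; rewrite ln_ge0 // ler1n prime_gt0.
apply: le_trans h _.
rewrite (_ : 12 * _ * _ = 2 * \sum_(0 <= i < I) (6 * ln 2)); last first.
  by rewrite sumr_const_nat subn0 -mulr_natr; ring.
rewrite ler_wpM2l //; apply: ler_sum => i _.
apply: (@le_trans _ _ ((nprimes (2 ^ i.+1))%:R * (i.+1%:R * ln 2) / (2 ^ i.+1)%:R)).
  rewrite ler_wpM2r ?invr_ge0 ?ler0n // -size_primes_le -sum1_size natr_sum mulr_suml.
  rewrite big_seq [leRHS]big_seq; apply: ler_sum => p; rewrite mem_primes_le => /andP[pp pi].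
  rewrite mul1r mulr_natl -lnXn ?ltr0n // ler_ln ?posrE ?exprn_gt0 ?ltr0n ?prime_gt0 //.
  by rewrite -natrX ler_nat.
rewrite mulrAC; have [_ h2] := nprimes_density i.
rewrite mulrA; apply: ler_wpM2r => //.
by rewrite -ler_pdivlMr ?ltr0n.
Qed.
End sums_over_primes.

Section class_sums.
Variables (R : realType) (f : nat -> R).
Hypothesis hf : classC f.
Notation H := (series (@harmonic R)).

Lemma classC_sums : exists2 C : R, 0 <= C & forall I,
  \sum_(p <- primes_le (2 ^ I)) f p / p%:R <= C * H I /\
  \sum_(p <- primes_le (2 ^ I)) f p ^+ 2 / p%:R <= C * H I.
Proof.
have [C C0 HC] := classC_second_moment hf; have f0 := classC_pos hf.
exists (12 * (1 + C)) => [|I]; first by rewrite mulr_ge0 // addr_ge0.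
have H0 : 0 <= H I by rewrite /series sumr_ge0 // => i _; rewrite invr_ge0 ler0n.
split.
  apply: sum_over_primes_le_harmonic => [p /f0/ltW //||i]; first by rewrite addr_ge0.
  apply: (@le_trans _ _ (\sum_(p <- primes_le (2 ^ i.+1)) (1 + f p ^+ 2))).
    by apply: ler_sum => p _; have := sqr_ge0 (1 - f p); rewrite !expr2; have := sqr_ge0 (f p); rewrite !expr2; nra.
  by rewrite big_split /= mulrDl mul1r lerD // -size_primes_le -sum1_size natr_sum.
apply: le_trans (@sum_over_primes_le_harmonic R (fun p => f p ^+ 2) C I _ C0 HC) _.
  by move=> p _; exact: sqr_ge0.
by rewrite ler_wpM2r // ler_wpM2l // lerDr.
Qed.

Lemma prime_count_le0 (x : R) : prime_count (fun p => f p <= 0) x = 0%N.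
Proof.
rewrite /prime_count /primes_upto; apply/eqP; rewrite -leqn0 leqNgt -has_count.
apply/hasPn => p; rewrite mem_filter => /andP[pp _]; by rewrite -ltNge (classC_pos hf).
Qed.

(** Positivity of [f] on the primes makes the empirical distribution at [0]
    vanish, hence [Psi 0 = 0]; right continuity at [0] then gives [d > 0] with
    [Psi d < 1 / 4]. *)
Lemma classC_frequently_large : exists2 d : R, 0 < d & exists i0, forall i, (i0 <= i)%N ->
  (nprimes (2 ^ i.+1))%:R / 2 <= (count (fun p => d < f p) (primes_le (2 ^ i.+1)))%:R :> R.
Proof.
have [Psi [_ HPsi]] := classC_distr hf; have [C HC] := HPsi 1 ltr01.
have Psi0 : Psi 0 = 0.
  apply/eqP; rewrite -normr_eq0; apply: contraT => Pn0.
  have P0 : 0 < `|Psi 0| by rewrite lt_neqAle eq_sym Pn0 normr_ge0.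
  have C0 := normr_ge0 C.
  set M := 1 + `|C| / `|Psi 0|.
  have M1 : 1 <= M by rewrite lerDl divr_ge0.
  have M0 : 0 < M by apply: lt_le_trans M1.
  have x2 : 2 <= expR M by have := expR_ge1Dx M; lra.
  have := HC (expR M) 0 x2; rewrite prime_count_le0 mul0r sub0r normrN expRK (powR_inv1 (ltW M0)).
  rewrite ler_pdivlMr // /M mulrDr mulr1 mulrCA divff // mulr1.
  have := ler_norm C; lra.
(* At the scales [i >= i0] the error [C / ln (2 ^ i.+1)] is below [1 / 4] too,
   which leaves at least half of the primes above [d]. *)
have [d d0 Pd] : exists2 d : R, 0 < d & Psi d < 4^-1.
  have : Psi t @[t --> (0:R)^'+] --> Psi 0 := cumulative_is_right_continuous Psi 0.
  rewrite Psi0 => /cvgrPdist_lt /(_ (4^-1)).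
  rewrite invr_gt0 ltr0n => /(_ isT) near.
  have : \forall t \near (0:R)^'+, 0 < t /\ Psi t < 4^-1.
    near=> t; split; first by near: t; exact: nbhs_right_gt.
    have : `|0 - Psi t| < 4^-1 by near: t.
    by rewrite sub0r normrN; apply: le_lt_trans (ler_norm _).
  by move=> /filter_ex[t [t0 tP]]; exists t.
exists d => //; exists (Num.truncn (4 * `|C| / ln 2)) => i ii0.
have l2 : 0 < ln 2 :> R by rewrite ln_gt0 // (_ : 1 = 1%:R) // ltr_nat.
have x2 : 2 <= (2 ^ i.+1)%:R :> R by rewrite ler_nat expnS leq_pmulr // expn_gt0.
have := HC _ d x2.
rewrite /prime_count /primepi /primes_upto natrK -/(primes_le _) size_primes_le.
rewrite natrX lnXn // powR_inv1; last by rewrite mulrn_wge0 // ltW.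
have n0 : 0 < (nprimes (2 ^ i.+1))%:R :> R.
  have [+ _] := nprimes_density R i.
  have i1 : 0 < 2^-1 / i.+1%:R :> R by rewrite divr_gt0.
  by move/(lt_le_trans i1); rewrite pmulr_lgt0 // invr_gt0 ltr0n expn_gt0.
set a := count _ _; have aE : (a + count (fun p => (d < f p)%R) (primes_le (2 ^ i.+1)) = nprimes (2 ^ i.+1))%N.
  rewrite -size_primes_le -(count_predC (fun p => (f p <= d)%R)); congr (_ + _)%N.
  by apply: eq_count => p /=; rewrite ltNge.
have h4 : C / (ln 2 *+ i.+1) <= 4^-1.
  rewrite ler_pdivrMr ?pmulrn_lgt0 // ler_pdivlMl //.
  apply: le_trans (_ : 4 * `|C| <= _); first by rewrite ler_wpM2l ?ler_norm.
  rewrite -[ln 2 *+ _]mulr_natl -ler_pdivrMr //; apply: (le_trans (ltW (truncnS_gt _))).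
  by rewrite ler_nat ltnS.
move=> h; have : a%:R / (nprimes (2 ^ i.+1))%:R <= 2^-1 :> R.
  have := le_trans (le_trans (ler_norm _) h) h4.
  by move: (a%:R / _) => r; lra.
rewrite ler_pdivrMr // => h2.
have := congr1 (fun n : nat => n%:R : R) aE; rewrite natrD; lra.
Unshelve. all: by end_near.
Qed.

(** The primes with [1 / p > eta] are finitely many, so that excluding them
    costs a constant. *)
Lemma classC_sum_inv_large : exists2 d : R, 0 < d & forall eta : R, 0 < eta ->
  exists K : R, forall I,
  H I / 8 - K <= \sum_(p <- primes_le (2 ^ I) | (d < f p) && (p%:R^-1 <= eta)) p%:R^-1.
Proof.
have [d d0 [i0 Hi]] := classC_frequently_large; exists d => // eta eta0.
set N := (Num.truncn eta^-1).+1.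
exists (i0%:R / 2 + N%:R) => I.
have h1 : \sum_(p <- primes_le (2 ^ I) | ~~ (p%:R^-1 <= eta)) p%:R^-1 <= N%:R :> R.
  apply: (@le_trans _ _ (\sum_(p <- primes_le (2 ^ I) | ~~ (p%:R^-1 <= eta)) 1)).
    rewrite big_seq_cond [leRHS]big_seq_cond; apply: ler_sum => p /andP[].
    by rewrite mem_primes_le => /andP[/(@inv_prime_itv R)[_ ->]].
  have -> : \sum_(p <- primes_le (2 ^ I) | ~~ (p%:R^-1 <= eta)) 1 =
      (count (fun p => ~~ (p%:R^-1 <= eta)) (primes_le (2 ^ I)))%:R :> R.
    by rewrite -sum1_count natr_sum.
  rewrite ler_nat -size_filter.
  rewrite -[leqRHS](size_iota 0); apply: uniq_leq_size; first by rewrite filter_uniq ?uniq_primes_le.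
  move=> p; rewrite mem_filter mem_primes_le mem_iota /= add0n -ltNge => /andP[h /andP[pp _]].
  rewrite /N -(ltr_nat R); apply: lt_trans (truncnS_gt _).
  by rewrite -[ltLHS]invrK ltf_pV2 // posrE // invr_gt0 ltr0n prime_gt0.
have h2 : H I / 8 - i0%:R / 2 <= \sum_(p <- primes_le (2 ^ I) | d < f p) p%:R^-1.
  pose g p : R := (d < f p)%R%:R.
  have [|_] := @dyadic_sum R g I; first by move=> p _; rewrite ler0n.
  have -> : \sum_(p <- primes_le (2 ^ I)) g p / p%:R =
      \sum_(p <- primes_le (2 ^ I) | d < f p) p%:R^-1.
    rewrite [RHS]big_mkcond; apply: eq_bigr => p _; rewrite /g.
    by case: (d < f p); rewrite ?mul1r ?mul0r.
  have h : H I / 4 - i0%:R <= \sum_(0 <= i < I) (\sum_(p <- primes_le (2 ^ i.+1)) g p) / (2 ^ i.+1)%:R.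
    apply: (@le_trans _ _ (\sum_(0 <= i < I) (4^-1 / i.+1%:R - (i < i0)%N%:R))).
      rewrite sumrB /series -mulr_sumr mulrC lerD2l lerN2 -natr_sum ler_nat.
      apply: (@leq_trans (minn I i0)); last exact: geq_minr.
      by elim: (I) => [|n IH]; [rewrite big_geq|rewrite big_nat_recr //=; lia].
    apply: ler_sum => i _.
    have -> : \sum_(p <- primes_le (2 ^ i.+1)) g p =
        (count (fun p => d < f p) (primes_le (2 ^ i.+1)))%:R.
      by rewrite -sum1_count natr_sum [RHS]big_mkcond; apply: eq_bigr => p _; rewrite /g; case: (d < f p).
    case: ltnP => [_|/Hi hi].
      apply: (@le_trans _ _ 0); last by rewrite divr_ge0.
      by rewrite subr_le0 -invfM -natrM invf_le1 ?ler1n ?ltr0n.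
    rewrite subr0; apply: (@le_trans _ _ ((nprimes (2 ^ i.+1))%:R / 2 / (2 ^ i.+1)%:R)).
      have [h3 _] := nprimes_density R i; rewrite mulrAC.
      have h20 : 0 <= 2^-1 :> R by rewrite invr_ge0.
      apply: le_trans (ler_wpM2r h20 h3).
      by move: (i.+1%:R^-1) => r; lra.
    by rewrite ler_wpM2r // invr_ge0.
  lra.
move: h2; rewrite (bigID (fun p : nat => p%:R^-1 <= eta)) /=.
suff : \sum_(p <- primes_le (2 ^ I) | (d < f p) && ~~ (p%:R^-1 <= eta)) p%:R^-1 <= N%:R :> R by lra.
apply: le_trans h1; rewrite [leLHS]big_mkcond [leRHS]big_mkcond; apply: ler_sum => p _.
by case: (d < f p) => //=; case: ifP => // _; rewrite invr_ge0.
Qed.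
End class_sums.

(** * The model error for the primes up to y *)

(** The scale at which [y] sits among powers of two; harmonic sums up to it play
    the part of [ln (ln y)]. *)
Definition dyadic_log (R : realType) (y : R) : nat := trunc_log 2 (Num.truncn y).

Section assembly.
Variable R : realType.
Notation H := (series (@harmonic R)).

Lemma dyadic_log_bounds (y : R) : 2 <= y -> 
  (0 < dyadic_log y)%N /\ (2 ^ dyadic_log y <= Num.truncn y < 2 ^ (dyadic_log y).+1)%N.
Proof.
move=> y2; have t2 : (2 <= Num.truncn y)%N by rewrite truncn_ge_nat //; lra.
split; first by apply: (@trunc_log_max 2 _ 1).
by apply: trunc_log_bounds => //; exact: leq_trans t2.
Qed.

Lemma dyadic_log_ln (y : R) : 2 <= y ->
  (dyadic_log y).+1%:R * ln 2 <= 2 * ln y /\ ln y <= (dyadic_log y).+1%:R * ln 2.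
Proof.
move=> y2; have [I0 /andP[I1 I2]] := dyadic_log_bounds y2.
have y0 : 0 < y by lra.
have l2 : 0 < ln 2 :> R by rewrite ln_gt0 //; lra.
have [t1 t2] := andP (truncn_itv (ltW y0)).
split; last first.
  rewrite mulr_natl -lnXn // -natrX ler_ln ?posrE ?ltr0n ?expn_gt0 //.
  by apply: le_trans (ltW t2) _; rewrite ler_nat.
have h : (dyadic_log y)%:R * ln 2 <= ln y.
  rewrite mulr_natl -lnXn // -natrX ler_ln ?posrE ?ltr0n ?expn_gt0 //.
  by apply: le_trans t1; rewrite ler_nat.
have : 1 <= (dyadic_log y)%:R :> R by rewrite ler1n.
rewrite -natr1; nra.
Qed.

Lemma sum_primes_le_mono (g : nat -> R) m n : (m <= n)%N -> (forall p, prime p -> 0 <= g p) ->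
  \sum_(p <- primes_le m) g p <= \sum_(p <- primes_le n) g p.
Proof.
move=> mn g0; rewrite (sum_primes_le_narrow _ mn) big_mkcond big_seq [leRHS]big_seq.
apply: ler_sum => p; rewrite mem_primes_le => /andP[pp _].
by case: ifP => // _; exact: g0.
Qed.

(** For [p <= y] the exponent [v = K * ln p / ln y] lies in [[0, K]], where
    [expR v <= 1 + v * expR K]; so [p ^ (K / ln y)] exceeds [1] by a multiple of
    [ln p / ln y], and the sum of [ln p / p] up to [y] is [O(ln y)].  It
    matters that [K] enters only the bounded term: a leading term multiplied by
    [expR K] would outgrow the gain, which is linear in [K]. *)
Lemma sum_powR_primes (y K : R) : 0 <= K -> 2 <= y ->
  \sum_(p <- primes_upto y) p%:R `^ (K / ln y - 1) <=
  12 * H (dyadic_log y).+1 + 24 * (K * expR K).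
Proof.
move=> K0 y2; have [I0 /andP[I1 I2]] := dyadic_log_bounds y2.
have [J1 J2] := dyadic_log_ln y2.
have ly : 0 < ln y by rewrite ln_gt0 //; lra.
have e0 := expR_ge0 K.
apply: (@le_trans _ _ (\sum_(p <- primes_upto y) (p%:R^-1 + K * expR K / ln y * (ln p%:R / p%:R)))).
  rewrite big_seq [leRHS]big_seq; apply: ler_sum => p.
  rewrite (mem_primes_le (Num.truncn y)) => /andP[pp py].
  have p0 : 0 < p%:R :> R by rewrite ltr0n prime_gt0.
  have lp0 : 0 <= ln p%:R :> R by rewrite ln_ge0 // ler1n prime_gt0.
  have lpy : ln p%:R <= ln y.
    rewrite ler_ln ?posrE //; last by lra.
    by apply: (@le_trans _ _ (Num.truncn y)%:R); rewrite ?ler_nat // truncn_le; lra.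
  rewrite powRB; last by rewrite (gt_eqF p0) implybT.
  rewrite (powRr1 (ltW p0)) (_ : _ + _ = (1 + K * expR K / ln y * ln p%:R) / p%:R); last by ring.
  rewrite ler_wpM2r ?invr_ge0 ?(ltW p0) //.
  rewrite /powR gt_eqF //; set v := K / ln y * ln p%:R.
  have vK : v <= K by rewrite /v mulrAC ler_pdivrMr // ler_wpM2l.
  have v0 : 0 <= v by rewrite /v mulr_ge0 // divr_ge0 // ltW.
  rewrite (_ : K * expR K / ln y * ln p%:R = v * expR K); last by rewrite /v; ring.
  have h1 : expR v <= expR K by rewrite ler_expR.
  have h2 : expR v * (1 - v) <= 1.
    by apply: le_trans (ler_wpM2l (expR_ge0 v) (expR_ge1Dx (- v))) _; rewrite expRxMexpNx_1.
  have := ler_wpM2l v0 h1; lra.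
rewrite big_split -mulr_sumr /=; apply: lerD.
  apply: le_trans (sum_inv_primes_le _ _).
  by apply: sum_primes_le_mono => [|p pp]; [exact: ltnW|rewrite invr_ge0].
have h : \sum_(p <- primes_upto y) ln p%:R / p%:R <= 24 * ln y.
  apply: (@le_trans _ _ (12 * ln 2 * (dyadic_log y).+1%:R)); last by lra.
  apply: le_trans (sum_ln_primes_le _ _).
  apply: sum_primes_le_mono => [|p pp]; first exact: ltnW.
  by rewrite divr_ge0 // ln_ge0 // ler1n prime_gt0.
have KK : 0 <= K * expR K / ln y by rewrite divr_ge0 ?mulr_ge0 // ltW.
apply: le_trans (ler_wpM2l KK h) _.
by rewrite mulrCA divfK ?gt_eqF.
Qed.

Lemma model_error_primes_upto (f : nat -> R) (phi : R -> R) (x y K : R) :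
  (forall t, `|phi t| <= 1) -> 0 <= K -> 2 <= y -> K <= ln y -> 0 < x ->
  `| x^-1 * \sum_(1 <= m < (Num.truncn x).+1 | (1 %| m)%N)
        phi (0 + \sum_(p <- primes_upto y | (p %| m)%N) f p)
     - model_mean f phi (primes_upto y) 0 |
  <= expR (24 * H (dyadic_log y).+1 + 48 * (K * expR K) - K * (ln x / ln y)).
Proof.
move=> phi1 K0 y2 Ky x0; have ly : 0 < ln y by rewrite ln_gt0 //; lra.
set s := primes_upto y.
have e01 : 0 <= K / ln y <= 1 by rewrite divr_ge0 ?(ltW ly) //= ler_pdivrMr // mul1r.
have := @model_error R f phi x (K / ln y) phi1 e01 x0 s 1 0 (uniq_primes_le _) (filter_all _ _).
rewrite divr1 => /(_ isT).
have -> : all (coprime 1) s by apply/allP => p _; rewrite coprime1n.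
move=> /(_ isT); set S := \sum_(1 <= m < _ | _) _; set M := model_mean _ _ _ _.
move=> h; have -> : x^-1 * S - M = x^-1 * (S - x * M).
  by rewrite mulrBr mulKf // gt_eqF.
rewrite normrM gtr0_norm ?invr_gt0 //.
apply: le_trans (ler_wpM2l _ h) _; first by rewrite invr_ge0 ltW.
rewrite powRB; last by rewrite (gt_eqF x0) implybT.
rewrite (powRr1 (ltW x0)) -mulrA mulKf ?(gt_eqF x0) //.
rewrite expRD [leRHS]mulrC ler_pM ?invr_ge0 ?powR_ge0 //.
- by apply: prodr_ge0 => p _; rewrite addr_ge0 // mulr_ge0 // powR_ge0.
- rewrite -powRN /powR gt_eqF // ler_expR le_eqVlt; apply/orP; left; apply/eqP; ring.
apply: (@le_trans _ _ (expR (2 * \sum_(p <- s) p%:R `^ (K / ln y - 1)))).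
  rewrite mulr_sumr expR_sum; apply: ler_prod => p _.
  by rewrite addr_ge0 ?mulr_ge0 ?powR_ge0 //= expR_ge1Dx.
rewrite ler_expR; have := sum_powR_primes K0 y2; rewrite -/s; lra.
Qed.
End assembly.

(** * Comparison of the tails *)

(** The threshold is at most [B * h * d], so that [j <= (B + 1) * h] successes
    among the primes with [d < f p] suffice, each contributing [d]. *)
Lemma classC_model_lower (R : realType) (f : nat -> R) (hf : classC f) (c : R) : 0 < c ->
  exists C1 H0 : R, forall y D : R, 2 <= y ->
    let h := series (@harmonic R) (dyadic_log y).+1 in
    H0 <= h -> 0 < sigmaf f y -> D <= c * sigmaf f y ->
    expR (- (C1 * h)) <=
      model_mean f (fun t => (D * sigmaf f y + meanf f y <= t)%R%:R) (primes_upto y) 0.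
Proof.
move=> c0; have f0 := classC_pos hf.
have [C C0 HC] := classC_sums hf; have [d d0 Hd] := classC_sum_inv_large hf.
pose B := (c + 1) * C / d.
have B0 : 0 <= B by rewrite divr_ge0 ?mulr_ge0 ?addr_ge0 // ltW.
(* [j] blocks of weight [2 * eta] then take up at most [h / 16] of the available
   weight, which is about [h / 8]. *)
pose eta := (32 * (B + 1))^-1.
have eta0 : 0 < eta by rewrite invr_gt0 mulr_gt0 // ltr_wpDl.
have [K HK] := Hd eta eta0.
pose rho := 1 - expR (- eta).
have rho0 : 0 < rho by rewrite subr_gt0 expR_lt1 oppr_lt0.
have rho1 : rho <= 1 by rewrite gerBl expR_ge0.
exists (- ln rho * (B + 1)), (3 + 16 * `|K|) => y D y2 h hH s0 Dc.
have [I0 /andP[I1 I2]] := dyadic_log_bounds y2.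
have h1 : 1 <= h by have := normr_ge0 K; lra.
have [HC1 HC2] := HC (dyadic_log y).+1; rewrite -/h in HC1 HC2.
have mu_le : meanf f y <= C * h.
  apply: le_trans HC1; apply: sum_primes_le_mono => [|p pp]; first exact: ltnW.
  by rewrite divr_ge0 // ltW // f0.
have sig_le : sigmaf f y ^+ 2 <= C * h.
  rewrite sqr_sqrtr; last first.
    rewrite big_seq; apply: sumr_ge0 => p; rewrite (mem_primes_le (Num.truncn y)) => /andP[pp _].
    have [_ p1] := @inv_prime_itv R p pp.
    by rewrite mulr_ge0 ?divr_ge0 ?sqr_ge0 // subr_ge0.
  apply: (@le_trans _ _ (\sum_(p <- primes_upto y) f p ^+ 2 / p%:R)).
    apply: ler_sum => p _; apply: ler_piMr; first by rewrite divr_ge0 ?sqr_ge0.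
    by rewrite gerBl invr_ge0.
  apply: le_trans HC2; apply: sum_primes_le_mono => [|p pp]; first exact: ltnW.
  by rewrite divr_ge0 // sqr_ge0.
set thr := D * _ + _.
have thr_le : thr <= B * h * d.
  rewrite (_ : B * h * d = c * (C * h) + C * h); last by rewrite /B; field; rewrite gt_eqF.
  rewrite lerD //; apply: le_trans (ler_wpM2r (ltW s0) Dc) _.
  by rewrite -mulrA -expr2 ler_wpM2l // ltW.
have Bh0 : 0 <= B * h by rewrite mulr_ge0 //; lra.
pose j := (Num.truncn (B * h)).+1.
have [j1 j2] := andP (truncn_itv Bh0).
have jle : j%:R <= (B + 1) * h by rewrite /j -natr1; lra.
have ps : all prime (primes_upto y) by exact: filter_all.
have HQ p : prime p -> (d < f p) && (p%:R^-1 <= eta) -> d <= f p /\ p%:R^-1 <= eta.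
  by move=> _ /andP[/ltW].
have := @model_lower R f thr (fun p pp => ltW (f0 p pp)) _ d eta (primes_upto y) j 0 HQ (ltW eta0) ps.
rewrite -/rho => H; apply: le_trans (H _ _).
- rewrite -[X in _ <= X ^+ j]lnK // -expRM_natl ler_expR.
  have lr : ln rho <= 0 by rewrite ln_le0.
  have := ler_wnM2l lr jle; lra.
- apply: (@le_trans _ _ (h / 16)).
    have := ler_wpM2r (ltW eta0) jle.
    have : (B + 1) * h * eta = h / 32 by rewrite /eta; field; lra.
    lra.
  have hI : h <= series (@harmonic R) (dyadic_log y) + 1.
    rewrite /h /series /= big_nat_recr //= lerD2l /harmonic invf_le1 ?ler1n ?ltr0n //.
  apply: (@le_trans _ _ (\sum_(p <- primes_le (2 ^ dyadic_log y) | (d < f p) && (p%:R^-1 <= eta)) p%:R^-1)).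
    apply: le_trans (HK _); have := ler_norm K; lra.
  rewrite [leLHS]big_mkcond [leRHS]big_mkcond; apply: sum_primes_le_mono => // p pp.
  by case: ifP => // _; rewrite invr_ge0.
- rewrite subr0; apply: le_trans thr_le _; rewrite ler_wpM2r ?(ltW d0) //.
  by rewrite /j ltW.
Qed.

Theorem proposition2p4 (R : realType)
    (d : measure_display) (T : measurableType d) (P : probability T R)
    (X : nat -> {RV P >-> R}) (hX : bernoulli_primes X)
    (f : nat -> R) (hf : classC f)
    (y : R -> R)
    (hy : same_order (fun x => ln x / ln (y x)) (fun x => ln (ln x)))
    (c : R) (hc : 0 < c) :
  equiv_uniformly (fun x => [set D : R | 1 <= D <= c * sigmaf f (y x)])
    (fun x D => int_tail f x (y x) D)
    (fun x D => model_tail X f (y x) D).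
Proof.
move=> e e0; have [a [b [a0 [b0 Hy]]]] := hy.
have [C1 [H0 Hlow]] := classC_model_lower hf hc.
have l2 : 0 < ln 2 :> R by rewrite ln_gt0 //; lra.
have l2' : ln 2 <= 1 :> R by rewrite -[2]/(1 + 1); have := @le_ln1Dx R 1; lra.
pose C1' := `|C1|.
(* The error has exponent [24 * h - K * u] and [a * h <= u] up to a constant,
   while the tail is at least [expR (- C1 * h)]: the choice leaves a spare
   factor [expR (- h)]. *)
pose K := (C1' + 25) / a.
have C1'0 : 0 <= C1' by exact: normr_ge0.
have K0 : 0 <= K by apply: divr_ge0; lra.
pose C2 := 1 + ln (2 / ln 2) : R.
pose G := K + `|H0| + `|48 * (K * expR K) + (C1' + 25) * C2 - ln e|.
have G0 : 0 <= G by rewrite !addr_ge0.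
(* [G] is a lower bound for the harmonic sum [h] that suffices in the end; once
   [ln (ln x) >= M], even [ln (ln (y x))] exceeds it. *)
pose M := 1 + a^-1 + 2 * (G + 1 + `|ln b|).
near=> x.
have /andP[u1 u2] : a * ln (ln x) <= ln x / ln (y x) <= b * ln (ln x) by near: x.
have xM : expR (expR M) <= x by near: x; apply: nbhs_pinfty_ge; rewrite num_real.
move=> D /= /andP[D1 D2].
have x0 : 0 < x by apply: lt_le_trans xM; exact: expR_gt0.
have lxM : expR M <= ln x by rewrite -[leLHS]expRK ler_ln ?posrE ?expR_gt0.
have lx0 : 0 < ln x by apply: lt_le_trans lxM; exact: expR_gt0.
set L := ln (ln x) in u1 u2.
have LM : M <= L by rewrite -[leLHS]expRK ler_ln ?posrE ?expR_gt0.
have ai0 : 0 < a^-1 by rewrite invr_gt0.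
have lb0 := normr_ge0 (ln b).
have L1 : 1 <= L by rewrite /M in LM; lra.
have aL : 1 <= a * L.
  rewrite -ler_pdivrMl // mulr1; rewrite /M in LM; lra.
have u0 : 1 <= ln x / ln (y x) by lra.
have ly0 : 0 < ln (y x).
  rewrite ltNge; apply/negP => h; have : ln x / ln (y x) <= 0.
    by rewrite mulr_ge0_le0 ?(ltW lx0) ?invr_le0.
  by lra.
have lyx : ln (y x) <= ln x by move: u0; rewrite ler_pdivlMr // mul1r.
have llyx : ln (ln (y x)) <= L by rewrite ler_ln.
(* The upper bound on [u] is what forces [y] to tend to infinity. *)
have Lb : L <= ln b + ln L + ln (ln (y x)).
  rewrite -!lnM ?posrE ?mulr_gt0 //; try lra.
  rewrite ler_ln ?posrE ?mulr_gt0 //; try lra.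
  by rewrite -ler_pdivrMr.
have lnL : ln L <= L / 2 + 1.
  have : ln (L / 2) < L / 2 by apply: ln_sublinear; lra.
  rewrite lnM ?posrE ?invr_gt0 //; last by lra.
  rewrite lnV ?posrE //; lra.
have lly : G <= ln (ln (y x)).
  have := ler_norm (ln b); rewrite /M in LM; lra.
have y1 : 1 < y x by rewrite ltNge; apply/negP => /ln_le0; lra.
have lyG : G <= ln (y x) by have := ln_sublinear ly0; lra.
have ly1 : 1 <= ln (y x).
  by rewrite -ler_ln ?posrE // ln1; lra.
have y2 : 2 <= y x.
  have := expR_ge1Dx (ln (y x)); rewrite lnK ?posrE; lra.
have [J1 J2] := dyadic_log_ln y2.
have [Ha _] := ln_harmonic R (dyadic_log (y x)).+1.
have [_ Hb] := ln_harmonic R (dyadic_log (y x)).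
set h := series _ (dyadic_log (y x)).+1 in Ha Hb.
have hG : G <= h.
  apply: le_trans Ha; apply: le_trans lly _.
  rewrite ler_ln ?posrE ?ltr0n //; apply: le_trans J2 _.
  apply: (@le_trans _ _ (dyadic_log (y x)).+1%:R); first by rewrite ler_piMr.
  by rewrite ler_nat.
have hL : h <= C2 + L.
  apply: le_trans Hb _; rewrite /C2 -addrA lerD2l.
  apply: le_trans (_ : ln (2 / ln 2 * ln (y x)) <= _).
    rewrite ler_ln ?posrE ?ltr0n ?mulr_gt0 ?invr_gt0 //.
    by rewrite mulrAC ler_pdivlMr.
  by rewrite lnM ?posrE ?mulr_gt0 ?invr_gt0 // lerD2l.
have s0 : 0 < sigmaf f (y x).
  rewrite lt_neqAle sqrtr_ge0 andbT eq_sym; apply/eqP => s0.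
  by move: D2; rewrite s0 mulr0; lra.
have n1 := ler_norm H0; have n1' := normr_ge0 H0.
have n2 := ler_norm (48 * (K * expR K) + (C1' + 25) * C2 - ln e).
have n2' := normr_ge0 (48 * (K * expR K) + (C1' + 25) * C2 - ln e).
have HH : H0 <= h by rewrite /G in hG; lra.
have low := Hlow (y x) D y2 HH s0 D2.
have KG : K <= ln (y x) by rewrite /G in lyG; lra.
have phi1 t : `|(D * sigmaf f (y x) + meanf f (y x) <= t)%R%:R| <= 1 :> R.
  by case: (_ <= t); rewrite ?normr1 ?normr0.
have := model_error_primes_upto f phi1 K0 y2 KG x0.
rewrite -int_tailE // -(model_tailE f _ _ hX) => kub.
rewrite -(model_tailE f _ _ hX) in low.
apply: le_trans kub _.
apply: (@le_trans _ _ (e * expR (- (C1 * h)))); last first.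
  rewrite ler_wpM2l ?(ltW e0) //; apply: le_trans low (ler_norm _).
rewrite -{1}(@lnK _ e) // -expRD ler_expR -/h.
have KL : (C1' + 25) * (h - C2) <= K * (ln x / ln (y x)).
  apply: (@le_trans _ _ ((C1' + 25) * L)).
    by rewrite ler_wpM2l ?addr_ge0 //; lra.
  apply: le_trans (ler_wpM2l K0 u1).
  by rewrite /K mulrA divfK // gt_eqF.
have C1h : C1 * h <= C1' * h by rewrite ler_wpM2r ?ler_norm //; lra.
rewrite /G in hG; lra.
Unshelve. all: by end_near.
Qed.
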